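(* For any unweighted directed graph $G$ and any vertex $v\in V(G)$, $\operatorname{ept}_{\mathrm{rzf}}(G,v)\ge \operatorname{rad}(G)$.
   Context: Directed graphs are finite. $\operatorname{rad}(G)=\min_{x\in V(G)}\max_{u\in V(G)}\operatorname{dist}(x,u)$, where $\operatorname{dist}(x,u)$ is the forward distance, i.e. the length of a shortest directed path from $x$ to $u$ ($\infty$ if there is none). Randomized zero forcing (RZF) on an unweighted directed graph $G$: start with blue set $B_0$. Given the blue set $B_t$, each white vertex $w\notin B_t$ independently becomes blue at round $t+1$ with probability equal to (number of in-neighbors of $w$ in $B_t$)/(indegree of $w$), and with probability $0$ if $w$ has indegree $0$; blue vertices stay blue forever. $\operatorname{ept}_{\mathrm{rzf}}(G,v)$ is the expected value of $\tau=\min\{t: B_t=V(G)\}$ started from $B_0=\{v\}$ if it is possible to color all of $G$ blue from $\{v\}$, and $\infty$ otherwise. *)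

(* Defs.v *)
From mathcomp Require Import all_boot all_order all_algebra.
From mathcomp Require Import all_classical all_reals all_analysis.

Set Implicit Arguments.
Unset Strict Implicit.
Unset Printing Implicit Defensive.

Import Order.TTheory GRing.Theory Num.Theory.
Import numFieldNormedType.Exports.

Local Open Scope classical_set_scope.
Local Open Scope ring_scope.

(* A finite directed graph is an edge relation [e] on [V : finType], with
   [e u w] standing for the arc u -> w. *)

Section Digraph.
Context (R : realType) (V : finType) (e : rel V).

(* The infimum of the empty set is [+oo]. *)
Definition digraph_dist (x u : V) : \bar R :=
  ereal_inf [set ((size p)%:R)%:E | p in [set p : seq V | path e x p /\ last x p = u]].

Definition digraph_rad : \bar R :=
  \big[Order.min/+oo%E]_(x : V) \big[Order.max/-oo%E]_(u : V) digraph_dist x u.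

Definition indegree (w : V) : nat := #|[pred u | e u w]|.

Definition force_prob (S : {set V}) (w : V) : R :=
  if indegree w == 0 then 0
  else #|[pred u in S | e u w]|%:R / (indegree w)%:R.

(* One round from blue set [S] to blue set [S']: independent coins for the
   white vertices, and no blue vertex is lost. *)
Definition rzf_trans (S S' : {set V}) : R :=
  if S \subset S' then
    \prod_(w | w \notin S)
      (if w \in S' then force_prob S w else 1 - force_prob S w)
  else 0.

Context (d : measure_display) (T : measurableType d) (P : probability T R).

(* [B t] is the random blue set after round [t]. In [rzf_step] the conditional
   law of [B t.+1] given the history [B 0 = h 0, ..., B t = h t] is written
   without division, so that histories of probability zero are unconstrained. *)
Record is_rzf (v : V) (B : nat -> T -> {set V}) : Prop := IsRzf {
  rzf_measurable : forall (t : nat) (S : {set V}),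
    measurable [set x | B t x = S] ;
  rzf_start : P [set x | B 0%N x = finset.set1 v] = 1%E ;
  rzf_step : forall (t : nat) (h : nat -> {set V}) (S' : {set V}),
    (P [set x | (forall i, (i <= t)%N -> B i x = h i) /\ B t.+1 x = S']
     = P [set x | forall i, (i <= t)%N -> B i x = h i]
       * (rzf_trans (h t) S')%:E)%E }.

(* [+oo] on trajectories that never become entirely blue. *)
Definition prop_time (B : nat -> T -> {set V}) (x : T) : \bar R :=
  ereal_inf [set (t%:R)%:E | t in [set t : nat | B t x = [set: V]%SET]].

Definition can_color (B : nat -> T -> {set V}) : Prop :=
  exists t : nat, (0 < P [set x | B t x = [set: V]%SET])%E.

Definition ept_rzf (B : nat -> T -> {set V}) : \bar R :=
  if `[< can_color B >] then (\int[P]_x prop_time B x)%E else +oo%E.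

End Digraph.

(* Main.v *)
Require Import Defs.
From mathcomp Require Import all_boot all_order all_algebra.
From mathcomp Require Import all_classical all_reals all_analysis.
From mathcomp Require Import measurable_realfun.

(** Almost surely every vertex that turns blue in a round has an in-neighbor
    that was already blue, so the blue set after [t] rounds stays within forward
    distance [t] of [v]. Hence the propagation time is almost surely at least the
    eccentricity of [v], which is at least the radius. *)

Set Implicit Arguments.
Unset Strict Implicit.
Unset Printing Implicit Defensive.

Import Order.TTheory GRing.Theory Num.Theory.

Local Open Scope classical_set_scope.
Local Open Scope ring_scope.

Section Distance.
Context (R : realType) (V : finType) (e : rel V).

Definition eccentricity (x : V) : \bar R :=
  \big[Order.max/-oo%E]_(u : V) digraph_dist R e x u.

Lemma digraph_rad_le_eccentricity (x : V) :
  (digraph_rad R e <= eccentricity x)%E.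
Proof. by rewrite /digraph_rad (bigD1 x) //= ge_min lexx. Qed.

Lemma digraph_dist_ge0 (x u : V) : (0 <= digraph_dist R e x u)%E.
Proof. by apply: le_ereal_inf_tmp => _ [p _ <-]; rewrite lee_fin. Qed.

Lemma eccentricity_ge0 (x : V) : (0 <= eccentricity x)%E.
Proof.
(* Isolating the term at [x] shows that the maximum is over a nonempty family, so its base value
   [-oo] does no harm. *)
by rewrite /eccentricity (bigD1 x) //= le_max digraph_dist_ge0.
Qed.

Lemma digraph_dist_le (x u : V) (p : seq V) (n : nat) :
  path e x p -> last x p = u -> (size p <= n)%N ->
  (digraph_dist R e x u <= n%:R%:E)%E.
Proof.
move=> xp pu pn; apply: (@le_trans _ _ (size p)%:R%:E).
  by apply: ereal_inf_lbound; exists p.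
by rewrite lee_fin ler_nat.
Qed.

End Distance.

Section Transition.
Context (R : realType) (V : finType) (e : rel V).

(** The product defining [rzf_trans] has [force_prob S w] as its factor at [w]; this factor vanishes
    when [w] has no in-neighbor in [S]. *)
Lemma rzf_trans_neq0 (S S' : {set V}) (w : V) :
  rzf_trans R e S S' != 0 -> w \in S' -> w \notin S ->
  exists2 u, u \in S & e u w.
Proof.
rewrite /rzf_trans; case: ifP => [_|_]; last by rewrite eqxx.
move=> /prodf_neq0/(_ w) + wS' wS; rewrite wS wS' => /(_ isT).
rewrite /force_prob; case: ifP => [_|_]; first by rewrite eqxx.
case: (pickP [pred u in S | e u w]) => [u /andP[uS euw] _|S0].
  by exists u.
by rewrite (eq_card0 S0) mul0r eqxx.
Qed.

(** The deterministic core, for a single trajectory, by induction on [t]: a vertex that is already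
    blue keeps its path, and a newly blue one extends the path of a blue in-neighbor by one arc. *)
Lemma rzf_traj_path (v : V) (b : nat -> {set V}) (t : nat) (w : V) :
  b 0%N = finset.set1 v ->
  (forall s, rzf_trans R e (b s) (b s.+1) != 0) ->
  w \in b t -> exists p, [/\ path e v p, last v p = w & (size p <= t)%N].
Proof.
move=> b0 btrans; elim: t w => [|t IHt] w.
  by rewrite b0 finset.in_set1 => /eqP ->; exists [::].
move=> wbt1; have [wbt|wbt] := boolP (w \in b t).
  by have [p [vp pw pt]] := IHt _ wbt; exists p; split; rewrite // leqW.
have [u ubt euw] := rzf_trans_neq0 (btrans t) wbt1 wbt.
have [p [vp pu pt]] := IHt _ ubt.
by exists (rcons p w); rewrite rcons_path last_rcons size_rcons vp pu.
Qed.

End Transition.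

Section Process.
Context (R : realType) (V : finType) (e : rel V).
Context (d : measure_display) (T : measurableType d) (P : probability T R).
Variables (v : V) (B : nat -> T -> {set V}).

Lemma prop_time_ge0 (x : T) : (0 <= prop_time R B x)%E.
Proof. by apply: le_ereal_inf_tmp => _ [t _ <-]; rewrite lee_fin. Qed.

Lemma eccentricity_le_prop_time (x : T) :
  B 0%N x = finset.set1 v ->
  (forall t, rzf_trans R e (B t x) (B t.+1 x) != 0) ->
  (eccentricity R e v <= prop_time R B x)%E.
Proof.
(* It suffices to bound each round [t] at which everything is blue; if there is none, the infimum is
   [+oo]. *)
move=> B0 Btrans; apply: le_ereal_inf_tmp => _ [t /= Bt <-].
apply/bigmax_leP; split => [|u _]; first exact: leNye.
have [|p [vp pu pt]] := @rzf_traj_path R V e v (B ^~ x) t u B0 Btrans.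
  by rewrite Bt finset.in_setT.
exact: digraph_dist_le vp pu pt.
Qed.

Hypothesis hB : is_rzf e P v B.

Lemma measurable_history (t : nat) (h : nat -> {set V}) :
  measurable [set x | forall i, (i <= t)%N -> B i x = h i].
Proof.
rewrite [X in measurable X](_ : _ =
  \bigcap_(i in `I_t.+1) [set x | B i x = h i]).
  by apply: fin_bigcap_measurable => // i _; exact: rzf_measurable hB i (h i).
by apply/seteqP; split.
Qed.

(** The propagation time is a countable infimum of two-valued functions: the [t]-th equals [t] on
    the event that all is blue after round [t], and [+oo] elsewhere. *)
Lemma measurable_prop_time : measurable_fun [set: T] (prop_time R B).
Proof.
pose f t x : \bar R := if B t x == [set: V]%SET then t%:R%:E else +oo%E.
have -> : prop_time R B = (fun x => einfs (f ^~ x) 0%N).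
  apply/funext => x; apply/eqP; rewrite eq_le; apply/andP; split.
    apply: le_ereal_inf_tmp => _ [t _ <-]; rewrite /f.
    case: eqP => [Bt|_]; last exact: leey.
    by apply: ereal_inf_lbound; exists t.
  apply: le_ereal_inf_tmp => _ [t /= Bt <-].
  by apply: ereal_inf_lbound; exists t => //; rewrite /f Bt eqxx.
apply: measurable_fun_einfs => t.
apply: measurable_fun_ifT; [|exact: measurable_cst|exact: measurable_cst].
apply: (measurable_fun_bool true); rewrite setTI.
rewrite [X in measurable X](_ : _ = [set x | B t x = [set: V]%SET]).
  exact: rzf_measurable hB _ _.
by apply/seteqP; split => x /= /eqP.
Qed.

Lemma ae_start : \forall x \ae P, B 0%N x = finset.set1 v.
Proof.
have mB0 := rzf_measurable hB 0 (finset.set1 v).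
exists (~` [set x | B 0%N x = finset.set1 v]); split => //.
  exact: measurableC.
by rewrite probability_setC // (rzf_start hB) subee.
Qed.

(* The past takes finitely many values, so it suffices to discard one null
   event for each history followed by a transition of probability zero. *)
Lemma ae_rzf_trans_neq0 (t : nat) :
  \forall x \ae P, rzf_trans R e (B t x) (B t.+1 x) != 0.
Proof.
(* Histories up to round [t] are encoded in a finite type, so that [filter_forall] can merge the
   null events; [inord i] is faithful only for [i <= t]. *)
pose hist (h : {ffun 'I_t.+1 -> {set V}}) (i : nat) := h (inord i).
have step (hS : {ffun 'I_t.+1 -> {set V}} * {set V}) : \forall x \ae P,
    rzf_trans R e (hist hS.1 t) hS.2 = 0 ->
    ~ ((forall i, (i <= t)%N -> B i x = hist hS.1 i) /\ B t.+1 x = hS.2).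
  case: hS => h S' /=.
  have [h0|h0] := eqVneq (rzf_trans R e (hist h t) S') 0; last first.
    by apply: aeW => x h1; move: h0; rewrite h1 eqxx.
  exists [set x | (forall i, (i <= t)%N -> B i x = hist h i) /\ B t.+1 x = S'].
  split.
  - exact: measurableI (measurable_history t _) (rzf_measurable hB _ _).
  - by rewrite (rzf_step hB) h0 mule0.
  - by move=> x /= /not_implyP[_ /contrapT].
have : \forall x \ae P, forall hS, rzf_trans R e (hist hS.1 t) hS.2 = 0 ->
    ~ ((forall i, (i <= t)%N -> B i x = hist hS.1 i) /\ B t.+1 x = hS.2).
  exact: filter_forall.
apply: filterS => x noBad.
have histE i : (i <= t)%N -> B i x = hist [ffun j : 'I_t.+1 => B j x] i.
  by move=> it; rewrite /hist ffunE inordK.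
apply/eqP => trans0.
(* The excluded pair is the one that [x] itself realizes. *)
apply: (noBad ([ffun j : 'I_t.+1 => B j x], B t.+1 x)) => //=.
by rewrite -histE.
Qed.

Lemma ae_eccentricity_le_prop_time :
  \forall x \ae P, (eccentricity R e v <= prop_time R B x)%E.
Proof.
(* There are countably many rounds, so a single null set serves them all. *)
have := ae_foralln ae_rzf_trans_neq0.
move: ae_start; apply: filterS2 => x; exact: eccentricity_le_prop_time.
Qed.

Lemma eccentricity_le_expected_prop_time :
  (eccentricity R e v <= \int[P]_x prop_time R B x)%E.
Proof.
(* Since [P] has total mass 1, the eccentricity is the integral of a constant, and monotonicity of
   the integral applies. *)
rewrite -[leLHS]mule1 -(@probability_setT _ _ _ P) -integral_cst //.
apply: ae_ge0_le_integral => //.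
- by move=> x _; exact: eccentricity_ge0.
- by move=> x _; exact: prop_time_ge0.
- exact: measurable_prop_time.
- by apply: filterS ae_eccentricity_le_prop_time => x.
Qed.

End Process.

Theorem theorem4p5 (R : realType) (V : finType) (e : rel V) (v : V)
    (d : measure_display) (T : measurableType d) (P : probability T R)
    (B : nat -> T -> {set V}) (hB : is_rzf e P v B) :
  (digraph_rad R e <= ept_rzf P B)%E.
Proof.
rewrite /ept_rzf; case: ifP => [_|_]; last exact: leey.
exact: le_trans (digraph_rad_le_eccentricity R e v)
                (eccentricity_le_expected_prop_time hB).
Qed.
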